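(* For every sufficiently large natural number $n$, for every natural number $\alpha$ and for every $x \in \{0,1\}^n$ such that $C(x) \geq \alpha + 7 \log n$, \[ |A_{x, \alpha}| \geq \frac{1}{2n^7}\, 2^{n-\alpha}, \] where $A_{x,\alpha} = \{y \in \{0,1\}^n \mid C(y) - C(y \mid x) \geq \alpha\}$.
   Context: $C(x)$ denotes the plain Kolmogorov complexity of the binary string $x$ with respect to a fixed universal Turing machine $U$, i.e. the length of a shortest program $p$ with $U(p)=x$; $C(x \mid y)$ denotes the conditional plain Kolmogorov complexity of $x$ given $y$ with respect to a fixed universal conditional machine, i.e. the length of a shortest $p$ with $U(p,y)=x$. Logarithms are base $2$. $|S|$ is the cardinality of a finite set $S$. *)

(* Defs.v *)
From mathcomp Require Import all_boot.
From Stdlib Require Import Reals ZArith ClassicalEpsilon.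

Set Implicit Arguments.
Unset Strict Implicit.
Unset Printing Implicit Defensive.

(* Model of computation: partial recursive (mu-recursive) functions on nat,  *)
(* with a fuel-indexed evaluator.  A program terminates with value v on      *)
(* input xs iff  exists k, eval k e xs = Some v.                             *)
Inductive prf : Type :=
| PZero
| PSucc
| PProj (i : nat)
| PComp (f : prf) (gs : seq prf)
| PRec (f g : prf)   (* h(0,ys)=f(ys), h(m+1,ys)=g(m,h(m,ys),ys) *)
| PMin (f : prf).    (* least m with f(m,xs)=0, all earlier values defined *)

Fixpoint eval (k : nat) (e : prf) (xs : seq nat) {struct k} : option nat :=
  match k with
  | 0 => None
  | k'.+1 =>
    match e with
    | PZero => Some 0
    | PSucc => Some (head 0 xs).+1
    | PProj i => Some (nth 0 xs i)
    | PComp f gs =>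
        let fix evals (gs : seq prf) : option (seq nat) :=
          match gs with
          | [::] => Some [::]
          | g :: gs' =>
              match eval k' g xs, evals gs' with
              | Some v, Some vs => Some (v :: vs)
              | _, _ => None
              end
          end in
        match evals gs with
        | Some vs => eval k' f vs
        | None => None
        end
    | PRec f g =>
        let ys := behead xs in
        let fix rec (m : nat) : option nat :=
          match m with
          | 0 => eval k' f ys
          | m'.+1 =>
              match rec m' with
              | Some r => eval k' g [:: m', r & ys]
              | None => None
              end
          end in
        rec (head 0 xs)
    | PMin f =>
        let fix search (j : nat) (m : nat) : option nat :=
          match j with
          | 0 => None
          | j'.+1 =>
              match eval k' f (m :: xs) with
              | Some 0 => Some m
              | Some _ => search j' m.+1
              | None => None
              end
          end in
        search k' 0
    end
  end.

(* Bijective coding of binary strings as naturals: s |-> (binary "1s") - 1. *)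
Definition code (s : seq bool) : nat :=
  (foldl (fun acc (b : bool) => acc.*2 + b) 1 s).-1.

(* Partial computable functions on binary strings (None = divergence). *)
Definition computable1 (M : seq bool -> option (seq bool)) : Prop :=
  exists e : prf, forall p y : seq bool,
    M p = Some y <-> exists k, eval k e [:: code p] = Some (code y).

Definition computable2 (M : seq bool -> seq bool -> option (seq bool)) : Prop :=
  exists e : prf, forall p z y : seq bool,
    M p z = Some y <-> exists k, eval k e [:: code p; code z] = Some (code y).

Definition universal (U : seq bool -> option (seq bool)) : Prop :=
  computable1 U /\
  forall M, computable1 M -> exists c : nat, forall p x,
    M p = Some x -> exists q, U q = Some x /\ size q <= size p + c.

Definition cond_universal (U : seq bool -> seq bool -> option (seq bool)) : Prop :=
  computable2 U /\
  forall M, computable2 M -> exists c : nat, forall p z x,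
    M p z = Some x -> exists q, U q z = Some x /\ size q <= size p + c.

(* Plain Kolmogorov complexity C_U(x): length of a shortest p with U p = x.
   (Defaults to 0 if x has no description, which never happens for a
   universal U.) *)
Definition has_desc (U : seq bool -> option (seq bool)) (x : seq bool) : pred nat :=
  fun k => [exists t : k.-tuple bool, U (tval t) == Some x].

Definition KC (U : seq bool -> option (seq bool)) (x : seq bool) : nat :=
  match excluded_middle_informative (exists k, has_desc U x k) with
  | left h => ex_minn h
  | right _ => 0
  end.

Definition has_cdesc (U : seq bool -> seq bool -> option (seq bool))
    (x y : seq bool) : pred nat :=
  fun k => [exists t : k.-tuple bool, U (tval t) y == Some x].

Definition KCc (U : seq bool -> seq bool -> option (seq bool)) (x y : seq bool) : nat :=
  match excluded_middle_informative (exists k, has_cdesc U x y k) with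
  | left h => ex_minn h
  | right _ => 0
  end.

Definition A_set (U : seq bool -> option (seq bool))
    (V : seq bool -> seq bool -> option (seq bool))
    (n alpha : nat) (x : n.-tuple bool) : {set n.-tuple bool} :=
  [set y : n.-tuple bool |
    Z.geb (Z.of_nat (KC U y) - Z.of_nat (KCc V y x))%Z (Z.of_nat alpha)].

(* Main.v *)
Require Import Defs.
From mathcomp Require Import all_boot zify.
From Stdlib Require Import Reals ZArith ClassicalEpsilon Lra.
(* Reals rebinds [^] on nat to [Nat.pow]; this restores [expn]. *)
Import ssrnat.

Set Implicit Arguments.
Unset Strict Implicit.
Unset Printing Implicit Defensive.

(* Let L = floor(log n), m = alpha + 6 L, k = C(x), and let z be the first m bits
   of a length-k program x* of x.  The required strings are y = z w with
   |w| = r = n - m.  Given x, such a y is computed from w and k, so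
   C(y | x) <= r + L + O(1); it therefore suffices that C(y) >= T for at least half
   of the w, where T = r + L + alpha + O(1).  Call z heavy if this fails.  Heavy
   prefixes are enumerable, and as fewer than 2^T strings have complexity below T
   there are at most 2^(alpha + L + O(1)) of them; so a heavy z is given by its rank
   together with n and alpha, and adding the remaining k - m bits of x* describes x
   by k - 2 L + O(1) bits, which is less than k.

   Strings s are handled through the number (code s).+1, written 1s in binary, so that
   concatenation and parsing are arithmetic with powers of 2. *)

(** * Computable functions of fixed arity *)

Definition conv (e : prf) (xs : seq nat) (v : nat) : Prop :=
  exists k, eval k e xs = Some v.

(** This fixpoint and the next two are the loops inside [eval] with the recursive call abstracted:
    each allows its own induction, and the equations for [eval] hold by computation. *)
Definition evals (ev : prf -> option nat) :=
  fix evals (gs : seq prf) : option (seq nat) :=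
  match gs with
  | [::] => Some [::]
  | g :: gs' =>
      match ev g, evals gs' with
      | Some v, Some vs => Some (v :: vs)
      | _, _ => None
      end
  end.

Definition recs (b : option nat) (st : nat -> nat -> option nat) :=
  fix recs (m : nat) : option nat :=
  match m with
  | 0 => b
  | m'.+1 => match recs m' with Some r => st m' r | None => None end
  end.

Definition search (f : nat -> option nat) :=
  fix search (j m : nat) : option nat :=
  match j with
  | 0 => None
  | j'.+1 =>
      match f m with
      | Some 0 => Some m
      | Some _ => search j' m.+1
      | None => None
      end
  end.

Lemma eval_comp k f gs xs :
  eval k.+1 (PComp f gs) xs =
  obind (fun vs => eval k f vs) (evals (fun g => eval k g xs) gs).
Proof. reflexivity. Qed.

Lemma eval_rec k f g xs :
  eval k.+1 (PRec f g) xs =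
  recs (eval k f (behead xs))
    (fun m r => eval k g [:: m, r & behead xs]) (head 0 xs).
Proof. reflexivity. Qed.

Lemma eval_min k f xs :
  eval k.+1 (PMin f) xs = search (fun m => eval k f (m :: xs)) k 0.
Proof. reflexivity. Qed.

Lemma evals_mono ev1 ev2 gs vs :
  (forall g v, ev1 g = Some v -> ev2 g = Some v) ->
  evals ev1 gs = Some vs -> evals ev2 gs = Some vs.
Proof.
move=> H; elim: gs vs => [|g gs IH] vs //=.
case E: (ev1 g) => [v|] //; rewrite (H _ _ E).
by case E2: (evals ev1 gs) => [ws|] // <-; rewrite (IH _ E2).
Qed.

Lemma recs_mono b1 b2 st1 st2 m v :
  (forall v, b1 = Some v -> b2 = Some v) ->
  (forall i r v, st1 i r = Some v -> st2 i r = Some v) ->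
  recs b1 st1 m = Some v -> recs b2 st2 m = Some v.
Proof.
move=> Hb Hs; elim: m v => [|m IH] v /=; first exact: Hb.
by case E: (recs b1 st1 m) => [r|] // /Hs; rewrite (IH _ E).
Qed.

Lemma search_mono f1 f2 j1 j2 m v :
  (forall i v, f1 i = Some v -> f2 i = Some v) -> j1 <= j2 ->
  search f1 j1 m = Some v -> search f2 j2 m = Some v.
Proof.
move=> Hf; elim: j1 j2 m => [|j IH] [|j2] m //= lej.
case E: (f1 m) => [[|w]|] //; rewrite (Hf _ _ E) //.
exact: IH.
Qed.

Lemma eval_mono k k' e xs v :
  k <= k' -> eval k e xs = Some v -> eval k' e xs = Some v.
Proof.
elim: k k' e xs v => [|k IH] [|k'] e xs v //; rewrite ltnS => lek.
have IH' e' ys w := IH k' e' ys w lek.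
case: e => [||i|f gs|f g|f] //; rewrite ?eval_comp ?eval_rec ?eval_min.
- case E: (evals _ gs) => [vs|] //=.
  by rewrite (evals_mono _ E) /=; [exact: IH' | move=> g w; exact: IH'].
- by apply: recs_mono => [w|i r w]; exact: IH'.
- by apply: search_mono => // i w; exact: IH'.
Qed.

Lemma conv_fun e xs v w : conv e xs v -> conv e xs w -> v = w.
Proof.
move=> [k Hk] [l Hl].
have := eval_mono (leq_maxl k l) Hk; rewrite (eval_mono (leq_maxr k l) Hl).
by case.
Qed.

(** Programs and values of the arguments are functions of an index in [js]; by monotonicity the
    maximum of the individual fuels serves for all of them. *)
Lemma conv_comp (I : Type) (p : I -> prf) (a : I -> nat) (js : seq I) f xs v :
  (forall i, conv (p i) xs (a i)) -> conv f (map a js) v ->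
  conv (PComp f (map p js)) xs v.
Proof.
move=> Hp [kf Hf].
have [k Hk] : exists k, evals (fun g => eval k g xs) (map p js) = Some (map a js).
  elim: js {Hf} => [|i js [k Hk]]; first by exists 0.
  have [l Hl] := Hp i; exists (maxn k l) => /=.
  rewrite (eval_mono (leq_maxr k l) Hl).
  rewrite (evals_mono _ Hk) // => g w; exact/eval_mono/leq_maxl.
exists (maxn k kf).+1; rewrite eval_comp (evals_mono _ Hk) /=.
  exact: eval_mono (leq_maxr k kf) Hf.
by move=> g w; apply/eval_mono/leq_maxl.
Qed.

Lemma conv_rec f g (F : nat) (G : nat -> nat -> nat) m xs :
  conv f xs F -> (forall i r, conv g [:: i, r & xs] (G i r)) ->
  conv (PRec f g) (m :: xs) (iteri m G F).
Proof.
move=> [kf Hf] Hg.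
have [k Hk] : exists k, recs (eval k f xs)
    (fun i r => eval k g [:: i, r & xs]) m = Some (iteri m G F).
  elim: m => [|m [k Hk]]; first by exists kf.
  have [l Hl] := Hg m (iteri m G F); exists (maxn k l) => /=.
  rewrite (recs_mono _ _ Hk) => [|w|i r w].
  - exact: eval_mono (leq_maxr k l) Hl.
  - exact/eval_mono/leq_maxl.
  - exact/eval_mono/leq_maxl.
by exists k.+1; rewrite eval_rec.
Qed.

Lemma conv_min f (F : nat -> nat) m xs :
  (forall i, conv f (i :: xs) (F i)) ->
  F m = 0 -> (forall i, i < m -> 0 < F i) -> conv (PMin f) xs m.
Proof.
move=> Hf Fm Fi.
have [k Hk] : exists k, forall i, i <= m -> eval k f (i :: xs) = Some (F i).
  elim: {Fi Fm} m => [|m [k Hk]].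
    by have [k Hk] := Hf 0; exists k; case.
  have [l Hl] := Hf m.+1; exists (maxn k l) => i.
  rewrite leq_eqVlt => /orP[/eqP->|]; first exact: eval_mono (leq_maxr k l) Hl.
  by move=> /Hk; apply/eval_mono/leq_maxl.
(* The fuel also bounds the number of candidates tried, and [m.+1] of them are tried. *)
exists (maxn k m.+1).+1; rewrite eval_min.
have: search (fun i => eval k f (i :: xs)) m.+1 0 = Some m.
  (* Induction on the distance [j] from the current candidate to [m]. *)
  suff H j : j <= m ->
      search (fun i => eval k f (i :: xs)) j.+1 (m - j) = Some m.
    by rewrite -[RHS](H m) // subnn.
  elim: j => [|j IH] lej.
    by rewrite subn0 /= Hk // Fm.
  rewrite -[j.+2]/(j.+1).+1 /= Hk ?leq_subr //.
  have := Fi (m - j.+1) ltac:(lia).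
  case: (F _) => // w _; have -> : (m - j.+1).+1 = m - j by lia.
  by apply: IH; lia.
apply: search_mono (leq_maxr _ _) => i w; exact/eval_mono/leq_maxl.
Qed.

(** * Closure properties of total computable functions *)

Definition tcomp (n : nat) (f : seq nat -> nat) : Prop :=
  exists e, forall xs, size xs = n -> conv e xs (f xs).

Lemma tcomp_ext n f g :
  (forall xs, size xs = n -> f xs = g xs) -> tcomp n f -> tcomp n g.
Proof. by move=> E [e He]; exists e => xs Hs; rewrite -E //; apply: He. Qed.

Lemma tcomp_nth n i : tcomp n (fun xs => nth 0 xs i).
Proof. by exists (PProj i) => xs _; exists 1. Qed.

Lemma tcomp_head n : tcomp n (head 0).
Proof. by apply: tcomp_ext (tcomp_nth n 0) => -[]. Qed.

Lemma tcomp_map n (F : seq nat -> nat) (fs : seq (seq nat -> nat)) :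
  (forall i, tcomp n (nth (fun _ => 0) fs i)) -> tcomp (size fs) F ->
  tcomp n (fun xs => F [seq f xs | f <- fs]).
Proof.
move=> Hfs [e He].
have Hc i : exists p, forall xs, size xs = n -> conv p xs (nth (fun _ => 0) fs i xs).
  exact: Hfs.
(* Only the existence of a program for each argument is known, so the programs are chosen. *)
pose p i := proj1_sig (constructive_indefinite_description _ (Hc i)).
have Hp i : forall xs, size xs = n -> conv (p i) xs (nth (fun _ => 0) fs i xs).
  by rewrite /p; case: constructive_indefinite_description.
exists (PComp e (map p (iota 0 (size fs)))) => xs Hs.
have -> : [seq f xs | f <- fs] =
    [seq nth (fun _ => 0) fs i xs | i <- iota 0 (size fs)].
  by rewrite -{1}(mkseq_nth (fun _ => 0) fs) -map_comp.
apply: conv_comp => [i|]; first exact: Hp.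
by apply: He; rewrite size_map size_iota.
Qed.

(** Replacing the first [d] arguments by the values of [fs] covers inserting, dropping and
    rearranging leading arguments, as the bodies of loops require. *)
Lemma tcomp_subst n d (F : seq nat -> nat) (fs : seq (seq nat -> nat)) :
  (forall i, tcomp n (nth (fun _ => 0) fs i)) -> tcomp (size fs + (n - d)) F ->
  tcomp n (fun xs => F ([seq f xs | f <- fs] ++ drop d xs)).
Proof.
move=> Hfs HF.
pose gs : seq (seq nat -> nat) := [seq (nth 0)^~ (d + i) | i <- iota 0 (n - d)].
apply: (@tcomp_ext _ (fun xs => F [seq f xs | f <- fs ++ gs])) => [xs Hs|].
  rewrite map_cat; congr (F (_ ++ _)); rewrite /gs -map_comp /=.
  apply: (@eq_from_nth _ 0); rewrite size_map size_iota ?size_drop ?Hs // => i Hi.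
  by rewrite (nth_map 0) ?size_iota // nth_iota //= add0n nth_drop.
apply: tcomp_map => [i|]; last by rewrite size_cat size_map size_iota.
rewrite nth_cat; case: ltnP => // Hi.
case: (ltnP (i - size fs) (n - d)) => Hj.
  by rewrite (nth_map 0) ?size_iota //; exact: tcomp_nth.
by rewrite nth_default ?size_map ?size_iota //; exists PZero => xs _; exists 1.
Qed.

Lemma tcomp_comp1 n (F : nat -> nat) a :
  tcomp 1 (fun xs => F (head 0 xs)) -> tcomp n a -> tcomp n (fun xs => F (a xs)).
Proof.
move=> HF Ha; apply: (tcomp_map (F := fun xs => F (head 0 xs)) (fs := [:: a])) HF.
by case=> [|[|i]] //=; exists PZero => xs _; exists 1.
Qed.

Lemma tcomp_behead n f : tcomp n f -> tcomp n.+1 (fun xs => f (behead xs)).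
Proof.
move=> Hf; apply: (@tcomp_ext _ (fun xs => f (drop 1 xs))) => [xs _|].
  by rewrite drop1.
apply: (tcomp_subst (d := 1) (fs := [::])); last by rewrite /= add0n subn1.
by move=> i; rewrite nth_nil; exists PZero => xs _; exists 1.
Qed.

Lemma tcomp_S n a : tcomp n a -> tcomp n (fun xs => (a xs).+1).
Proof. by apply: (@tcomp_comp1 n succn); exists PSucc => xs _; exists 1. Qed.

Lemma tcomp_const n c : tcomp n (fun _ => c).
Proof.
elim: c => [|c IH]; last exact: tcomp_S.
by exists PZero => xs _; exists 1.
Qed.

Lemma tcomp_iteri n a f (G : nat -> nat -> seq nat -> nat) :
  tcomp n a -> tcomp n f ->
  tcomp n.+2 (fun ys => G (nth 0 ys 0) (nth 0 ys 1) (behead (behead ys))) ->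
  tcomp n (fun xs => iteri (a xs) (fun m r => G m r xs) (f xs)).
Proof.
move=> Ha [ef Hf] [eg Hg].
pose F ys := iteri (head 0 ys) (fun m r => G m r (behead ys)) (f (behead ys)).
(* [PRec] recurses on its first argument, so the bound is inserted in front. *)
apply: (@tcomp_ext _ (fun xs => F ([seq g xs | g <- [:: a]] ++ drop 0 xs))).
  by move=> xs _; rewrite drop0.
apply: tcomp_subst.
  by case=> [|[|i]] //; exact: tcomp_const.
rewrite subn0 /=; exists (PRec ef eg) => -[|m xs] // [Hs].
apply: conv_rec => [|i r]; first exact: Hf.
by apply: (Hg [:: i, r & xs]); rewrite /= Hs.
Qed.

Lemma tcomp_weak2 n f : tcomp n f -> tcomp n.+2 (fun xs => f (behead (behead xs))).
Proof. by move=> /tcomp_behead /tcomp_behead. Qed.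

Lemma tcomp_add n a b : tcomp n a -> tcomp n b -> tcomp n (fun xs => a xs + b xs).
Proof.
move=> Ha Hb.
apply: (@tcomp_ext _ (fun xs => iteri (a xs) (fun _ r => r.+1) (b xs))) => [xs _|].
  by elim: (a xs) => //= m ->.
by apply: tcomp_iteri => //; apply/tcomp_S/tcomp_nth.
Qed.

Lemma tcomp_pred n a : tcomp n a -> tcomp n (fun xs => (a xs).-1).
Proof.
move=> Ha.
apply: (@tcomp_ext _ (fun xs => iteri (a xs) (fun m _ => m) 0)) => [xs _|].
  by case: (a xs).
by apply: tcomp_iteri => //; [exact: tcomp_const | exact: tcomp_nth].
Qed.

Lemma tcomp_sub n a b : tcomp n a -> tcomp n b -> tcomp n (fun xs => a xs - b xs).
Proof.
move=> Ha Hb.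
apply: (@tcomp_ext _ (fun xs => iteri (b xs) (fun _ r => r.-1) (a xs))) => [xs _|].
  by elim: (b xs) => /= [|m ->]; rewrite ?subn0 ?subnS.
by apply: tcomp_iteri => //; apply/tcomp_pred/tcomp_nth.
Qed.

Lemma tcomp_mul n a b : tcomp n a -> tcomp n b -> tcomp n (fun xs => a xs * b xs).
Proof.
move=> Ha Hb.
apply: (@tcomp_ext _ (fun xs => iteri (a xs) (fun _ r => r + b xs) 0)) => [xs _|].
  by elim: (a xs) => //= m ->; rewrite mulSn addnC.
apply: (tcomp_iteri (G := fun _ r xs => r + b xs)) => //; first exact: tcomp_const.
by apply: tcomp_add; [exact: tcomp_nth | exact: tcomp_weak2].
Qed.

Lemma tcomp_exp2 n a : tcomp n a -> tcomp n (fun xs => 2 ^ a xs).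
Proof.
move=> Ha.
apply: (@tcomp_ext _ (fun xs => iteri (a xs) (fun _ r => r + r) 1)) => [xs _|].
  by elim: (a xs) => // m IH; rewrite [LHS]/= IH expnS mul2n addnn.
apply: tcomp_iteri => //; first exact: tcomp_const.
by apply: tcomp_add; exact: tcomp_nth.
Qed.

Lemma tcomp_sum n a (F : nat -> seq nat -> nat) :
  tcomp n a -> tcomp n.+1 (fun ys => F (head 0 ys) (behead ys)) ->
  tcomp n (fun xs => \sum_(i < a xs) F i xs).
Proof.
move=> Ha HF.
apply: (@tcomp_ext _ (fun xs => iteri (a xs) (fun m r => r + F m xs) 0)) => [xs _|].
  by elim: (a xs) => [|m /= ->]; rewrite ?big_ord0 ?big_ord_recr.
apply: (tcomp_iteri (G := fun m r xs => r + F m xs)) => //; first exact: tcomp_const.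
apply: tcomp_add; first exact: tcomp_nth.
have := @tcomp_subst n.+2 2 _ [:: head 0] _ _.
move/(_ (fun ys => F (head 0 ys) (behead ys))) => H.
apply: (tcomp_ext _ (H _ _)) => [[|x [|y xs]] _ //=|[|[|i]]|].
- by rewrite drop0.
- exact: tcomp_head.
- exact: tcomp_const.
- exact: tcomp_const.
- by rewrite /= addnC !subSS subn0 addn1.
Qed.

Lemma tcomp_leq n a b : tcomp n a -> tcomp n b -> tcomp n (fun xs => a xs <= b xs : nat).
Proof.
move=> Ha Hb.
apply: (@tcomp_ext _ (fun xs => 1 - (a xs - b xs))) => [xs _|].
  by rewrite -[a xs <= b xs]/(a xs - b xs == 0); case: (a xs - b xs).
by apply: tcomp_sub; [exact: tcomp_const | exact: tcomp_sub].
Qed.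

Lemma tcomp_eq n a b : tcomp n a -> tcomp n b -> tcomp n (fun xs => a xs == b xs : nat).
Proof.
move=> Ha Hb.
apply: (@tcomp_ext _ (fun xs => (a xs <= b xs) * (b xs <= a xs))) => [xs _|].
  by rewrite eqn_leq mulnb.
by apply: tcomp_mul; exact: tcomp_leq.
Qed.

(** Quotient, logarithm and 2-adic valuation become bounded sums: each counts the [i] that pass a
    decidable threshold test. *)
Lemma sum_lt (t v : nat) : t <= v -> \sum_(i < v) (i < t) = t.
Proof.
elim: v t => [|v IH] t; first by rewrite leqn0 big_ord0 => /eqP.
rewrite big_ord_recr /= leq_eqVlt => /orP[/eqP->|].
  rewrite (eq_bigr (fun=> 1)) => [|i _]; first by rewrite sum1_card card_ord ltnS leqnn addn1.
  by rewrite ltnS ltnW.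
by rewrite ltnS => H; rewrite IH // ltnNge H addn0.
Qed.

Lemma tcomp_div2 n a b :
  tcomp n a -> tcomp n b -> tcomp n (fun xs => a xs %/ 2 ^ b xs).
Proof.
move=> Ha Hb.
apply: (@tcomp_ext _ (fun xs => \sum_(i < a xs) (i.+1 * 2 ^ b xs <= a xs))) => [xs _|].
  rewrite -[RHS](@sum_lt _ (a xs)) ?leq_div //.
  by apply: eq_bigr => i _; rewrite leq_divRL ?expn_gt0.
apply: (tcomp_sum (F := fun i xs => i.+1 * 2 ^ b xs <= a xs : nat)) => //.
apply: tcomp_leq; last exact: tcomp_behead.
apply: tcomp_mul; first exact/tcomp_S/tcomp_head.
exact/tcomp_exp2/tcomp_behead.
Qed.

Lemma tcomp_mod2 n a b :
  tcomp n a -> tcomp n b -> tcomp n (fun xs => a xs %% 2 ^ b xs).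
Proof.
move=> Ha Hb.
apply: (@tcomp_ext _ (fun xs => a xs - a xs %/ 2 ^ b xs * 2 ^ b xs)) => [xs _|].
  by rewrite {1}(divn_eq (a xs) (2 ^ b xs)) addKn.
apply: tcomp_sub => //; apply: tcomp_mul; first exact: tcomp_div2.
exact: tcomp_exp2.
Qed.

Lemma tcomp_trunc_log n a : tcomp n a -> tcomp n (fun xs => trunc_log 2 (a xs)).
Proof.
move=> Ha.
apply: (@tcomp_ext _ (fun xs => \sum_(i < a xs) (2 ^ i.+1 <= a xs))) => [xs _|].
  case: (posnP (a xs)) => [->|a0]; first by rewrite big_ord0.
  rewrite -[RHS](@sum_lt _ (a xs)).
    apply: eq_bigr => i _; congr nat_of_bool.
    apply/idP/idP => [|lti]; first exact: trunc_log_max.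
    by apply: leq_trans (trunc_logP (isT : 1 < 2) a0); rewrite ?leq_pexp2l.
  by apply: leq_trans (trunc_logP (isT : 1 < 2) a0) => //; apply/ltnW/ltn_expl.
apply: (tcomp_sum (F := fun i xs => 2 ^ i.+1 <= a xs : nat)) => //.
apply: tcomp_leq; last exact: tcomp_behead.
exact/tcomp_exp2/tcomp_S/tcomp_head.
Qed.

Lemma leq_logn2 a : logn 2 a <= a.
Proof.
case: (posnP a) => [->|a0]; first by rewrite logn0.
apply: leq_trans (ltnW (ltn_expl _ (isT : 1 < 2))) _.
by apply: dvdn_leq a0 _; exact: pfactor_dvdnn.
Qed.

Lemma tcomp_logn2 n a : tcomp n a -> tcomp n (fun xs => logn 2 (a xs)).
Proof.
move=> Ha.
apply: (@tcomp_ext _ (fun xs => \sum_(i < a xs) (a xs %% 2 ^ i.+1 == 0))) => [xs _|].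
  case: (posnP (a xs)) => [->|a0]; first by rewrite big_ord0 logn0.
  rewrite -[RHS](@sum_lt _ (a xs)); last exact: leq_logn2.
  by apply: eq_bigr => i _; rewrite -[_ == 0]/(2 ^ i.+1 %| a xs) pfactor_dvdn.
apply: (tcomp_sum (F := fun i xs => a xs %% 2 ^ i.+1 == 0 : nat)) => //.
apply: tcomp_eq; last exact: tcomp_const.
apply: tcomp_mod2; first exact: tcomp_behead.
exact/tcomp_S/tcomp_head.
Qed.

Lemma tcomp_prod n (fs : seq (seq nat -> nat)) :
  (forall i, tcomp n (nth (fun _ => 0) fs i)) ->
  tcomp n (fun xs => \prod_(f <- fs) f xs).
Proof.
elim: fs => [|f fs IH] Hfs.
  by apply: tcomp_ext (tcomp_const n 1) => xs _; rewrite big_nil.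
apply: (@tcomp_ext _ (fun xs => f xs * \prod_(f <- fs) f xs)) => [xs _|].
  by rewrite big_cons.
by apply: tcomp_mul; [exact: (Hfs 0) | apply: IH => i; exact: (Hfs i.+1)].
Qed.

(** * Computability of evaluation with bounded fuel *)

(** With 0 for failure, evaluation with fuel is a total numerical function. *)
Definition enc (o : option nat) : nat := if o is Some v then v.+1 else 0.

Definition stepf (e : prf) (ys : seq nat) : nat := enc (eval (head 0 ys) e (behead ys)).

(** The argument programs of [PComp] sit in a nested list; the induction hypothesis reaches them by
    position, with default [PZero]. *)
Fixpoint prf_ind_all (P : prf -> Prop)
    (h0 : P PZero) (hS : P PSucc) (hp : forall i, P (PProj i))
    (hc : forall f gs, P f -> (forall i, P (nth PZero gs i)) -> P (PComp f gs))
    (hr : forall f g, P f -> P g -> P (PRec f g))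
    (hm : forall f, P f -> P (PMin f)) (e : prf) {struct e} : P e :=
  let ind := prf_ind_all h0 hS hp hc hr hm in
  match e with
  | PZero => h0
  | PSucc => hS
  | PProj i => hp i
  | PComp f gs => hc f gs (ind f)
      ((fix all_nth (gs : seq prf) (i : nat) : P (nth PZero gs i) :=
        match gs, i return P (nth PZero gs i) with
        | [::], 0 => h0
        | [::], _.+1 => h0
        | g :: _, 0 => ind g
        | _ :: gs', i'.+1 => all_nth gs' i'
        end) gs)
  | PRec f g => hr f g (ind f) (ind g)
  | PMin f => hm f (ind f)
  end.

(** The product is nonzero exactly when every argument is defined. *)
Lemma evals_enc ev gs :
  evals ev gs = if \prod_(g <- gs) enc (ev g) is _.+1
                then Some [seq (enc (ev g)).-1 | g <- gs] else None.
Proof.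
elim: gs => [|g gs IH]; first by rewrite big_nil.
rewrite big_cons /= IH; case: (ev g) => [v|] //=.
by case: (\prod_(_ <- _) _) => [|p]; rewrite ?muln0 ?mulnS.
Qed.

Lemma recs_enc b st m :
  enc (recs b st m) =
  iteri m (fun i r => (0 < r) * enc (st i r.-1)) (enc b).
Proof.
by elim: m => //= m <-; case: (recs b st m) => [r|] //=; rewrite mul1n.
Qed.

(* The fold tracks 0 for failure, 1 while still searching, m + 2 for a zero at m. *)
Lemma search_enc f k :
  enc (search f k 0) =
  (iteri k (fun i r => if r == 1 then
     (if enc (f i) == 1 then i.+2 else 0 < enc (f i) : nat) else r) 1).-1.
Proof.
set G := fun i r => _.
(* Every state other than 1 is absorbing. *)
have fixG j m r : r != 1 -> iteri j (fun i => G (m + i)) r = r.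
  by move=> /negbTE rn1; elim: j => //= j ->; rewrite /G rn1.
suff H m : enc (search f k m) = (iteri k (fun i => G (m + i)) 1).-1.
  by rewrite H.
elim: k m => [|k IH] m //=.
(* [iteri] unfolds at its last step but [search] at its first, so the first candidate is split
   off. *)
have -> : forall r, G (m + k) (iteri k (fun i => G (m + i)) r) =
    iteri k (fun i => G (m.+1 + i)) (G m r).
  move=> r; elim: k {IH} => [|k IHk] /=; first by rewrite addn0.
  by rewrite IHk addSnnS.
by rewrite {2}/G /=; case: (f m) => [[|v]|] /=; rewrite ?IH // fixG.
Qed.

Lemma tcomp_if n a b c : tcomp n a -> tcomp n b -> tcomp n c ->
  tcomp n (fun xs => if a xs == 1 then b xs else c xs).
Proof.
move=> Ha Hb Hc.
apply: (@tcomp_ext _ (fun xs => (a xs == 1) * b xs + (1 - (a xs == 1)) * c xs)).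
  by move=> xs _; case: (_ == _); rewrite ?mul1n ?addn0 ?mul0n.
have Ha1 : tcomp n (fun xs => a xs == 1) by apply: tcomp_eq => //; exact: tcomp_const.
apply: tcomp_add; apply: tcomp_mul => //.
by apply: tcomp_sub => //; exact: tcomp_const.
Qed.

(** By induction on the fixed program [e]: evaluation with fuel [k.+1] is a bounded loop over
    evaluations of its parts with fuel [k]. This is what makes running all programs in parallel
    computable. *)
Lemma tcomp_stepf n e : tcomp n.+1 (stepf e).
Proof.
(* An iteration that ignores its accumulator is a case distinction: 0 for fuel 0, and [B k] for fuel
   [k.+1]. *)
have case_fuel m e' (B : nat -> seq nat -> nat) :
    (forall k xs, size xs = m -> enc (eval k.+1 e' xs) = B k xs) ->
    tcomp m.+1 (fun ys => B (head 0 ys) (behead ys)) -> tcomp m.+1 (stepf e').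
  move=> HB tB.
  apply: (@tcomp_ext _ (fun ys => iteri (head 0 ys) (fun k _ => B k (behead ys)) 0)).
    by case=> [|[|k] xs] // [Hs]; exact/esym/HB.
  apply: (tcomp_iteri (G := fun k _ ys => B k (behead ys))).
  - exact: tcomp_head.
  - exact: tcomp_const.
  have H := @tcomp_subst m.+3 3 (fun ys => B (head 0 ys) (behead ys)) [:: head 0].
  apply: (tcomp_ext _ (H _ _)) => [[|x [|y [|z xs]]] _ //=|[|[|i]]|].
  - by rewrite drop0.
  - exact: tcomp_head.
  - exact: tcomp_const.
  - exact: tcomp_const.
  - by rewrite /= !subSS subn0.
elim/prf_ind_all: e n => [||i|f gs IHf IHgs|f g IHf IHg|f IHf] n.
- by apply: (case_fuel _ _ (fun _ _ => 1)) => //; exact: tcomp_const.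
- apply: (case_fuel _ _ (fun _ xs => (head 0 xs).+2)) => //.
  exact/tcomp_S/tcomp_S/tcomp_behead/tcomp_head.
- apply: (case_fuel _ _ (fun _ xs => (nth 0 xs i).+1)) => //.
  exact/tcomp_S/(tcomp_behead (f := fun xs => nth 0 xs i))/tcomp_nth.
- apply: (case_fuel _ _ (fun k xs => (0 < \prod_(g <- gs) stepf g (k :: xs)) *
    stepf f (k :: [seq (stepf g (k :: xs)).-1 | g <- gs]))).
    move=> k xs _; rewrite eval_comp evals_enc /=.
    rewrite (eq_bigr (fun g => stepf g (k :: xs))) //.
    by case: (\prod_(_ <- _) _) => //= p; rewrite mul1n.
  have tg i : tcomp n.+1 (nth (fun _ => 0) [seq stepf g | g <- gs] i).
    case: (ltnP i (size gs)) => Hi; last by rewrite nth_default ?size_map //; exact: tcomp_const.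
    by rewrite (nth_map PZero) //.
  apply: (@tcomp_ext _ (fun ys => (1 <= \prod_(F <- [seq stepf g | g <- gs]) F ys) *
     stepf f [seq F ys | F <- head 0 :: [seq (fun ys => (stepf g ys).-1) | g <- gs]])).
    by case=> [|k xs] // _; rewrite big_map /= -map_comp.
  apply: tcomp_mul.
    by apply: tcomp_leq; [exact: tcomp_const | exact: tcomp_prod].
  apply: tcomp_map => [[|i]|]; first exact: tcomp_head; last first.
    by rewrite /= size_map.
  case: (ltnP i (size gs)) => Hi; last by rewrite /= nth_default ?size_map //; exact: tcomp_const.
  rewrite /= (nth_map PZero) //; apply: tcomp_pred.
  exact: IHgs.
- apply: (case_fuel _ _ (fun k xs => iteri (head 0 xs)
    (fun i r => (0 < r) * stepf g [:: k, i, r.-1 & behead xs])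
    (stepf f (k :: behead xs)))).
    by move=> k xs _; rewrite eval_rec recs_enc.
  apply: (tcomp_iteri (a := fun ys => head 0 (behead ys))
    (f := fun ys => stepf f (head 0 ys :: behead (behead ys)))
    (G := fun i r ys => (1 <= r) * stepf g [:: head 0 ys, i, r.-1 & behead (behead ys)])).
  + exact/tcomp_behead/tcomp_head.
  + have H := @tcomp_subst n.+1 2 (stepf f) [:: head 0].
    apply: (tcomp_ext _ (H _ _)) => [[|x [|y xs]] _ //=|[|[|i]]|]; rewrite ?drop0 //.
    * exact: tcomp_head.
    * exact: tcomp_const.
    * exact: tcomp_const.
  + apply: tcomp_mul.
      by apply: tcomp_leq; [exact: tcomp_const | exact: tcomp_nth].
    have H := @tcomp_subst n.+3 4 (stepf g)
      [:: (nth 0)^~ 2; (nth 0)^~ 0; (fun ys => (nth 0 ys 1).-1)].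
    apply: (tcomp_ext _ (H _ _)) => [[|x [|y [|z xs]]] _ //=|[|[|[|i]]]|].
    * by case: xs => //= *; rewrite drop0.
    * exact: tcomp_nth.
    * exact: tcomp_nth.
    * exact/tcomp_pred/tcomp_nth.
    * by rewrite /= nth_nil; exact: tcomp_const.
    * exact: IHg.
- apply: (case_fuel _ _ (fun k xs => (iteri k (fun i r => if r == 1 then
     (if stepf f [:: k, i & xs] == 1 then i.+2
      else 1 <= stepf f [:: k, i & xs] : nat) else r) 1).-1)).
    by move=> k xs _; rewrite eval_min search_enc.
  apply: tcomp_pred.
  apply: (tcomp_iteri (G := fun i r ys => if r == 1 then
     (if stepf f [:: head 0 ys, i & behead ys] == 1 then i.+2
      else 1 <= stepf f [:: head 0 ys, i & behead ys] : nat) else r)).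
  + exact: tcomp_head.
  + exact: tcomp_const.
  have tf : tcomp n.+3 (fun ys => stepf f [:: head 0 (behead (behead ys)),
      nth 0 ys 0 & behead (behead (behead ys))]).
    have H := @tcomp_subst n.+3 3 (stepf f) [:: (nth 0)^~ 2; (nth 0)^~ 0].
    apply: (tcomp_ext _ (H _ _)) => [[|x [|y [|z xs]]] _ //=|[|[|i]]|].
    * by rewrite drop0.
    * exact: tcomp_nth.
    * exact: tcomp_nth.
    * by rewrite /= nth_nil; exact: tcomp_const.
    * by rewrite /= !subSS subn0; exact: IHf.
  apply: tcomp_if; try exact: tcomp_nth.
  apply: tcomp_if => //; first exact/tcomp_S/tcomp_S/tcomp_nth.
  by apply: tcomp_leq => //; exact: tcomp_const.
Qed.

(** Both decoders below have this shape: an unbounded search for the least [s] that passes a test,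
    then a total computation from [s]. *)
Lemma conv_search n (R : nat -> seq nat -> bool) (F : nat -> seq nat -> nat) :
  tcomp n.+1 (fun ys => R (head 0 ys) (behead ys)) ->
  tcomp n.+1 (fun ys => F (head 0 ys) (behead ys)) ->
  exists e, forall xs s, size xs = n -> R s xs ->
    (forall i, i < s -> ~~ R i xs) -> conv e xs (F s xs).
Proof.
move=> HR [eF HF].
have [eR HeR] : tcomp n.+1 (fun ys => 1 - R (head 0 ys) (behead ys)).
  by apply: tcomp_sub => //; exact: tcomp_const.
(* The arguments passed to [eF] are the found [s] followed by a copy of [xs]. *)
exists (PComp eF [seq if i is j.+1 then PProj j else PMin eR | i <- iota 0 n.+1]).
move=> xs s Hs Rs Ri.
have -> : F s xs = F (head 0 (s :: xs)) (behead (s :: xs)) by [].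
have Hc : conv (PMin eR) xs s.
  apply: (conv_min (F := fun i => 1 - R i xs)) => [i||i lti].
  - by apply: (HeR (i :: xs)); rewrite /= Hs.
  - by rewrite Rs.
  - by rewrite (negbTE (Ri _ lti)).
have Es : s :: xs = [seq if i is j.+1 then nth 0 xs j else s | i <- iota 0 n.+1].
  by rewrite /= -[1]addn0 iotaDl -map_comp -Hs map_nth_iota0 // take_size.
apply: (conv_comp (a := fun i => if i is j.+1 then nth 0 xs j else s));
  last by rewrite -Es; apply: HF; rewrite /= Hs.
by case=> [|i] //; exists 1.
Qed.

Lemma tcomp_stepf2 n e a b :
  tcomp n a -> tcomp n b -> tcomp n (fun xs => stepf e [:: a xs; b xs]).
Proof.
move=> Ha Hb; apply: (tcomp_map (F := stepf e) (fs := [:: a; b])).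
  by case=> [|[|i]] //=; rewrite nth_nil; exact: tcomp_const.
exact: tcomp_stepf.
Qed.

Lemma tcomp_nth_behead n i : tcomp n (fun xs => nth 0 (behead xs) i).
Proof. by apply: tcomp_ext (tcomp_nth n i.+1) => xs _; rewrite nth_behead. Qed.

Lemma conv_stepf e xs v : conv e xs v <-> exists t, stepf e (t :: xs) = v.+1.
Proof.
split=> -[k]; first by move=> Hk; exists k; rewrite /stepf /= Hk.
by rewrite /stepf /=; case E: (eval k e xs) => [w|] //= [<-]; exists k.
Qed.

Ltac tc := repeat first
  [ assumption | exact: tcomp_const | exact: tcomp_head | exact: tcomp_nth
  | exact: tcomp_nth_behead
  | apply: tcomp_S | apply: tcomp_exp2 | apply: tcomp_div2 | apply: tcomp_mod2
  | apply: tcomp_trunc_log | apply: tcomp_logn2 | apply: tcomp_stepf2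
  | apply: tcomp_add | apply: tcomp_sub | apply: tcomp_mul | apply: tcomp_pred
  | apply: tcomp_eq | apply: tcomp_leq | apply: tcomp_behead ].

(** * Codes of strings and complexity bounds *)

Lemma code_rcons s b : (code (rcons s b)).+1 = (code s).+1.*2 + b.
Proof.
have pos t : 0 < foldl (fun acc (b : bool) => acc.*2 + b) 1 t.
  elim/last_ind: t => // t c IH; rewrite foldl_rcons.
  by apply: leq_trans (leq_addr _ _); rewrite double_gt0.
by rewrite /code !prednK // foldl_rcons.
Qed.

Lemma code_bounds s : 2 ^ size s <= (code s).+1 < 2 ^ (size s).+1.
Proof.
elim/last_ind: s => // s b /andP[H1 H2].
rewrite code_rcons size_rcons !expnS -!mul2n in H1 H2 *.
by apply/andP; split; case: b; lia.
Qed.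

Lemma code_inj : injective code.
Proof.
elim/last_ind=> [|s b IH] t; elim/last_ind: t => [|t c _] // H.
- by have := code_rcons t c; rewrite -H (_ : code [::] = 0) //; case: c {H} => /=; lia.
- by have := code_rcons s b; rewrite H (_ : code [::] = 0) //; case: b {H} => /=; lia.
have := congr1 succn H; rewrite !code_rcons => E.
have bc : b = c by case: b c {H} E => -[] //; lia.
by rewrite bc (IH t) //; move: E; rewrite bc; lia.
Qed.

Fixpoint bits (l v : nat) : seq bool :=
  if l is l'.+1 then rcons (bits l' v./2) (odd v) else [::].

Lemma size_bits l v : size (bits l v) = l.
Proof. by elim: l v => //= l IH v; rewrite size_rcons IH. Qed.

Lemma code_bits l v : v < 2 ^ l -> (code (bits l v)).+1 = 2 ^ l + v.
Proof.
elim: l v => [|l IH] v; first by case: v.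
rewrite expnS => Hv; rewrite /= code_rcons IH; last by lia.
by rewrite -[in RHS](odd_double_half v); lia.
Qed.

Lemma bits_code v : exists s, (code s).+1 = v.+1 /\ size s = trunc_log 2 v.+1.
Proof.
have /andP[] := @trunc_log_bounds 2 v.+1 isT isT.
set l := trunc_log 2 v.+1; rewrite expnS => H1 H2.
exists (bits l (v.+1 - 2 ^ l)); rewrite size_bits code_bits; lia.
Qed.

Lemma trunc_log_code s : trunc_log 2 (code s).+1 = size s.
Proof. exact/trunc_log_eq/code_bounds. Qed.

(** Universality speaks of machines on strings, so a program is turned into one. Halting is
    undecidable, hence excluded middle and choice; the output is unique because [code] is
    injective. *)
Lemma computable1_prf e : exists2 M, computable1 M &
  forall p y, M p = Some y <-> conv e [:: code p] (code y).
Proof.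
pose P p y := conv e [:: code p] (code y).
pose M p := match excluded_middle_informative (exists y, P p y) with
  | left h => Some (proj1_sig (constructive_indefinite_description _ h))
  | right _ => None
  end.
suff HM p y : M p = Some y <-> P p y by exists M => //; exists e.
rewrite /M; case: excluded_middle_informative => [h|h].
  case: constructive_indefinite_description => z /= Pz; split=> [[<-] //|Py].
  by congr Some; apply/code_inj/(conv_fun Pz Py).
by split=> // Py; case: h; exists y.
Qed.

Lemma computable2_prf e : exists2 M, computable2 M &
  forall p z y, M p z = Some y <-> conv e [:: code p; code z] (code y).
Proof.
pose P p z y := conv e [:: code p; code z] (code y).
pose M p z := match excluded_middle_informative (exists y, P p z y) with
  | left h => Some (proj1_sig (constructive_indefinite_description _ h))
  | right _ => None
  end.
suff HM p z y : M p z = Some y <-> P p z y by exists M => //; exists e.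
rewrite /M; case: excluded_middle_informative => [h|h].
  case: constructive_indefinite_description => v /= Pv; split=> [[<-] //|Py].
  by congr Some; apply/code_inj/(conv_fun Pv Py).
by split=> // Py; case: h; exists y.
Qed.

Lemma KC_le U p x : U p = Some x -> KC U x <= size p.
Proof.
move=> H; rewrite /KC; case: excluded_middle_informative => // h.
case: ex_minnP => k _; apply; apply/existsP.
by exists (in_tuple p); rewrite /= H.
Qed.

Lemma KCc_le V p x y : V p y = Some x -> KCc V x y <= size p.
Proof.
move=> H; rewrite /KCc; case: excluded_middle_informative => // h.
case: ex_minnP => k _; apply; apply/existsP.
by exists (in_tuple p); rewrite /= H.
Qed.

(** Invariance in the form used for upper bounds: any program serves as a decoder at the cost of an
    additive constant. *)
Lemma KC_prf U e : universal U ->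
  exists c, forall p y, conv e [:: code p] (code y) -> KC U y <= size p + c.
Proof.
move=> [_ HU]; have [M /HU[c Hc] HM] := computable1_prf e.
by exists c => p y /HM/Hc[q [/KC_le]]; apply: leq_trans.
Qed.

Lemma KCc_prf V e : cond_universal V ->
  exists c, forall p z y, conv e [:: code p; code z] (code y) ->
    KCc V y z <= size p + c.
Proof.
move=> [_ HV]; have [M /HV[c Hc] HM] := computable2_prf e.
by exists c => p z y /HM/Hc[q [/KCc_le]]; apply: leq_trans.
Qed.

Lemma KC_size U : universal U -> exists c, forall x, KC U x <= size x + c.
Proof.
move=> /(KC_prf (PProj 0)) [c Hc]; exists c => x.
by apply: Hc; exists 1.
Qed.

Lemma KC_ex U x : universal U -> exists2 p, U p = Some x & size p = KC U x.
Proof.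
move=> HU; have [M cM HM] := computable1_prf (PProj 0).
have [c /(_ x x) Hc] := HU.2 M cM.
have [|q [Uq _]] := Hc; first by apply/HM; exists 1.
rewrite /KC; case: excluded_middle_informative => [h|[]]; last first.
  by exists (size q); apply/existsP; exists (in_tuple q); rewrite /= Uq.
case: ex_minnP => k /existsP[t /eqP Ut] _.
by exists t; rewrite ?size_tuple.
Qed.

(** * Enumeration of the heavy prefixes *)

(* The s-th step runs the program with code [s mod 2 ^ T] for [s / 2 ^ T] steps; the value
   is 0 if it has not halted, and otherwise the number 1y of its output y. *)
Definition out (e : prf) (T s : nat) : nat := stepf e [:: s %/ 2 ^ T; s %% 2 ^ T].

Definition hit e T s v : bool := 0 < \sum_(j < s) (out e T j == v).

(* Here and below u is the number 1z of a prefix z, so that u * 2 ^ r + w is 1zw. *)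
Definition hits e T r s u : nat := \sum_(w < 2 ^ r) hit e T s (u * 2 ^ r + w).

Definition heavy e T r s u : bool := 2 ^ r <= 2 * hits e T r s u.

Definition heavies e T r m s : nat := \sum_(z < 2 ^ m) heavy e T r s (2 ^ m + z).

Lemma hitP e T s v :
  reflect (exists2 j, j < s & out e T j = v) (hit e T s v).
Proof.
rewrite /hit lt0n sum_nat_eq0 negb_forall; apply: (iffP existsP).
  by move=> [j]; case: (out e T j =P v) => // <- _; exists j.
by move=> [j ltj <-]; exists (Ordinal ltj); rewrite /= eqxx.
Qed.

Lemma hit_mono e T s s' v : s <= s' -> hit e T s v -> hit e T s' v.
Proof.
by move=> le /hitP[j ltj <-]; apply/hitP; exists j => //; apply: leq_trans le.
Qed.

Lemma hits_mono e T r s s' u : s <= s' -> hits e T r s u <= hits e T r s' u.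
Proof.
move=> le; apply: leq_sum => w _.
by case: (boolP (hit e T s _)) => // /(hit_mono le) ->.
Qed.

Lemma heavy_mono e T r s s' u : s <= s' -> heavy e T r s u -> heavy e T r s' u.
Proof.
by move=> /(hits_mono e T r u) le /leq_trans; apply; rewrite leq_mul2l.
Qed.

Lemma heavies_mono e T r m s s' :
  s <= s' -> heavies e T r m s <= heavies e T r m s'.
Proof.
move=> le; apply: leq_sum => z _.
by case: (boolP (heavy e T r s _)) => // /(heavy_mono le) ->.
Qed.

Lemma stepf_fun e t t' xs :
  0 < stepf e (t :: xs) -> 0 < stepf e (t' :: xs) ->
  stepf e (t :: xs) = stepf e (t' :: xs).
Proof.
case E: (stepf e (t :: xs)) => [|v] // _.
case E': (stepf e (t' :: xs)) => [|v'] // _; congr _.+1.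
by apply: (@conv_fun e xs); apply/conv_stepf; [exists t | exists t'].
Qed.

(** A nonzero output depends on the program only and not on the number of steps, so at most [2 ^ T]
    nonzero values ever appear. *)
Lemma out_values e T :
  exists f : nat -> nat, forall s, 0 < out e T s -> out e T s = f (s %% 2 ^ T).
Proof.
pose P q v := 0 < v /\ exists t, stepf e [:: t; q] = v.
exists (fun q => epsilon (inhabits 0) (P q)) => s s0.
have [|v0 [t Ht]] := epsilon_spec (inhabits 0) (P (s %% 2 ^ T)).
  by exists (out e T s); split=> //; exists (s %/ 2 ^ T).
by rewrite -Ht; apply: stepf_fun => //; rewrite Ht.
Qed.

(* Distinct pairs (z, w) with a hit are produced by distinct programs q < 2 ^ T. *)
Lemma heavies_bound e T r m s : heavies e T r m s * 2 ^ r <= 2 * 2 ^ T.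
Proof.
rewrite big_distrl /=.
pose v (p : 'I_(2 ^ m) * 'I_(2 ^ r)) := (2 ^ m + p.1) * 2 ^ r + p.2.
(* At least half of the [2 ^ r] extensions of a heavy prefix are hit. *)
apply: (@leq_trans (2 * \sum_(z < 2 ^ m) hits e T r s (2 ^ m + z))).
  rewrite big_distrr /=; apply: leq_sum => z _.
  by case: (boolP (heavy e T r s _)) => H; rewrite ?mul0n ?mul1n.
rewrite leq_mul2l /= /hits pair_bigA /=.
have -> : \sum_(p : 'I_(2 ^ m) * 'I_(2 ^ r)) hit e T s ((2 ^ m + p.1) * 2 ^ r + p.2) =
    #|[pred p | hit e T s (v p)]|.
  rewrite -sum1_card [RHS]big_mkcond; apply: eq_bigr => p _; rewrite inE /v.
  by case: (hit e T s _).
have vinj : injective v.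
  move=> [z w] [z' w']; rewrite /v /= => H.
  have p2 : 0 < 2 ^ r by rewrite expn_gt0.
  have := congr1 (divn^~ (2 ^ r)) H; have := congr1 (modn^~ (2 ^ r)) H.
  rewrite /= !modnMDl !divnMDl // !modn_small // !divn_small // !addn0.
  by move=> /ord_inj -> /addnI /ord_inj ->.
have [f Hf] := out_values e T.
(* The hit numbers 1zw are distinct and lie among the values of [f] on the [2 ^ T] programs. *)
rewrite -[2 ^ T](size_iota 0) -(size_map f) cardE -(size_map v).
apply: uniq_leq_size; first by rewrite map_inj_uniq ?enum_uniq.
move=> y /mapP[p]; rewrite mem_enum inE => /hitP[j _ Hj] ->.
(* The leading 1 makes 1zw positive, so it is not the value 0 of an unfinished run. *)
rewrite -Hj Hf; last by rewrite Hj /v addn_gt0 muln_gt0 addn_gt0 !expn_gt0.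
by apply: map_f; rewrite mem_iota /= add0n ltn_mod expn_gt0.
Qed.

(* The s-th output is the one that makes z heavy, so it has prefix z; no other
   information than the number i of prefixes that were heavy before is needed. *)
Lemma heavy_rank e T r m s0 z :
  z < 2 ^ m -> heavy e T r s0 (2 ^ m + z) ->
  exists s i, [/\ i < heavies e T r m s.+1,
    forall s', s' < s -> heavies e T r m s'.+1 <= i &
    out e T s %/ 2 ^ r = 2 ^ m + z].
Proof.
move=> ltz Hs0; have p2 : 0 < 2 ^ r by rewrite expn_gt0.
have ex : exists s, heavy e T r s (2 ^ m + z) by exists s0.
(* [s.+1] is the first time at which z is heavy; time 0 is excluded since nothing is hit yet. *)
have [[|s] Hs min] := ex_minnP ex.
  have h0 : hits e T r 0 (2 ^ m + z) = 0.
    by rewrite /hits big1 // => w _; rewrite /hit big_ord0.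
  by move: Hs; rewrite /heavy h0 leqNgt p2.
have Ns : ~~ heavy e T r s (2 ^ m + z).
  by apply/negP => /min; rewrite ltnn.
exists s, (heavies e T r m s); split.
- rewrite /heavies [X in X < _](bigD1 (Ordinal ltz)) // [X in _ < X](bigD1 (Ordinal ltz)) //=.
  rewrite Hs (negbTE Ns) add0n add1n ltnS; apply: leq_sum => z' _.
  by case: (boolP (heavy e T r s _)) => // /(heavy_mono (leqnSn s)) ->.
- by move=> s' lts; exact: heavies_mono.
(* To become heavy, z needs a new extension to be hit, and that extension is the output of step
   [s]. *)
have lt : hits e T r s (2 ^ m + z) < hits e T r s.+1 (2 ^ m + z).
  by move: Hs Ns; rewrite /heavy; lia.
have [w Hw Nw] : exists2 w : 'I_(2 ^ r), hit e T s.+1 ((2 ^ m + z) * 2 ^ r + w)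
    & ~~ hit e T s ((2 ^ m + z) * 2 ^ r + w).
  apply: NNPP => H; move: lt; rewrite ltnNge => /negP[]; apply: leq_sum => w _.
  case H1: (hit e T s.+1 _) => //; case H2: (hit e T s _) => //.
  by case: H; exists w; rewrite ?H1 ?H2.
have /hitP[j] := Hw; rewrite ltnS leq_eqVlt => /orP[/eqP-> ->|ltj Hj].
  by rewrite divnMDl // divn_small // addn0.
by case/negP: Nw; apply/hitP; exists j.
Qed.

(** Each [w] has its own hitting time; the maximum of these finitely many times serves for all. *)
Lemma hits_exhaust e T r u (B : pred nat) :
  (forall w, w < 2 ^ r -> B w -> exists s, hit e T s (u * 2 ^ r + w)) ->
  exists s, \sum_(w < 2 ^ r) B w <= hits e T r s u.
Proof.
move=> HB.
suff H k : k <= 2 ^ r ->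
    exists s, forall w, w < k -> B w -> hit e T s (u * 2 ^ r + w).
  have [s Hs] := H _ (leqnn _).
  exists s; apply: leq_sum => w _.
  by case: (boolP (B w)) => // Bw; rewrite Hs.
elim: k => [|k IH] lek; first by exists 0.
have [s Hs] := IH (ltnW lek).
case: (boolP (B k)) => [/(HB _ lek) [s' Hs']|NB]; last first.
  exists s => w; rewrite ltnS leq_eqVlt => /orP[/eqP->|]; last exact: Hs.
  by rewrite (negbTE NB).
exists (maxn s s') => w; rewrite ltnS leq_eqVlt => /orP[/eqP-> _|ltw Bw].
  exact: hit_mono (leq_maxr _ _) Hs'.
exact: hit_mono (leq_maxl _ _) (Hs w ltw Bw).
Qed.

Lemma tcomp_out e n T s :
  tcomp n T -> tcomp n s -> tcomp n (fun xs => out e (T xs) (s xs)).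
Proof. by move=> HT Hs; rewrite /out; tc. Qed.

Lemma tcomp_hit e n T s v :
  tcomp n T -> tcomp n s -> tcomp n v ->
  tcomp n (fun xs => hit e (T xs) (s xs) (v xs)).
Proof.
move=> HT Hs Hv; apply: tcomp_leq; first exact: tcomp_const.
apply: (tcomp_sum (F := fun j xs => out e (T xs) j == v xs : nat)) => //.
by apply: tcomp_eq; [apply: tcomp_out|]; tc.
Qed.

Lemma tcomp_heavies e n T r m s :
  tcomp n T -> tcomp n r -> tcomp n m -> tcomp n s ->
  tcomp n (fun xs => heavies e (T xs) (r xs) (m xs) (s xs)).
Proof.
move=> HT Hr Hm Hs.
apply: (tcomp_sum (F := fun z xs => heavy e (T xs) (r xs) (s xs) (2 ^ m xs + z) : nat)).
  by tc.
apply: tcomp_leq; first by tc.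
apply: tcomp_mul; first by tc.
apply: (tcomp_sum (F := fun w xs => hit e (T (behead xs)) (s (behead xs))
   ((2 ^ m (behead xs) + head 0 xs) * 2 ^ r (behead xs) + w) : nat)); first by tc.
by apply: tcomp_hit; tc; apply: (tcomp_behead (f := fun xs => _ (behead xs))); tc.
Qed.

(** * Parsing of fields and the two decoding programs *)

Lemma divn_field a j b : b < 2 ^ j -> (a * 2 ^ j + b) %/ 2 ^ j = a.
Proof. by move=> H; rewrite divnMDl ?expn_gt0 // divn_small // addn0. Qed.

Lemma modn_field a j b : b < 2 ^ j -> (a * 2 ^ j + b) %% 2 ^ j = b.
Proof. by move=> H; rewrite modnMDl modn_small. Qed.

Lemma trunc_log_field d w : w < 2 ^ d -> trunc_log 2 (2 ^ d + w) = d.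
Proof. by move=> H; apply: trunc_log_eq => //; rewrite expnS; lia. Qed.

(** The final block 1 0^L is self-delimiting: its trailing zeros reveal L, and with it the widths of
    the other fields. *)
Lemma logn_field a L : logn 2 (a * 2 ^ L.+1 + 2 ^ L) = L.
Proof.
have -> : a * 2 ^ L.+1 + 2 ^ L = (a.*2.+1) * 2 ^ L by rewrite expnS; lia.
rewrite lognM ?expn_gt0 // pfactorK // lognE /= dvdn2 /=.
by rewrite odd_double.
Qed.

(* Program w ++ k on input x: find some length-k program of x, keep its first
   n - |w| bits and append w. *)
Lemma splice_prf e : exists p, forall k w d x s,
  let n := trunc_log 2 x.+1 in
  let L := trunc_log 2 n in
  k < 2 ^ (L + 2) -> w < 2 ^ d ->
  let R s := stepf e [:: s %/ 2 ^ k; (2 ^ k + s %% 2 ^ k).-1] == x.+1 in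
  R s -> (forall i, i < s -> ~~ R i) ->
  conv p [:: ((2 ^ d + w) * 2 ^ (L + 2) + k).-1; x]
    ((2 ^ k + s %% 2 ^ k) %/ 2 ^ (k - (n - d)) * 2 ^ d + w).-1.
Proof.
(* Parsing from the low-order end: the length of x gives the width of the field of k, and what
   remains is 1w, whose logarithm is |w|. *)
pose len xs := trunc_log 2 (nth 0 xs 1).+1.
pose W xs := trunc_log 2 (len xs) + 2.
pose K xs := (nth 0 xs 0).+1 %% 2 ^ W xs.
pose Q xs := (nth 0 xs 0).+1 %/ 2 ^ W xs.
pose D xs := trunc_log 2 (Q xs).
have tlen : tcomp 2 len by rewrite /len; tc.
have tW : tcomp 2 W by rewrite /W; tc.
have tK : tcomp 2 K by rewrite /K; tc.
have tQ : tcomp 2 Q by rewrite /Q; tc.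
have tD : tcomp 2 D by rewrite /D; tc.
pose R s xs := stepf e [:: s %/ 2 ^ K xs; (2 ^ K xs + s %% 2 ^ K xs).-1] == (nth 0 xs 1).+1.
pose F s xs := ((2 ^ K xs + s %% 2 ^ K xs) %/ 2 ^ (K xs - (len xs - D xs)) * 2 ^ D xs
  + (Q xs - 2 ^ D xs)).-1.
have [||p Hp] := @conv_search 2 R F; first by rewrite /R; tc.
  by rewrite /F; tc.
exists p => k w d x s n L ltk ltw R' Rs Ri.
set xs := [:: _; x].
have E0 : (nth 0 xs 0).+1 = (2 ^ d + w) * 2 ^ (L + 2) + k.
  by rewrite /= prednK // addn_gt0 muln_gt0 addn_gt0 !expn_gt0.
have EK : K xs = k by rewrite /K E0 modn_field.
have EQ : Q xs = 2 ^ d + w by rewrite /Q E0 divn_field.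
have ED : D xs = d by rewrite /D EQ trunc_log_field.
have := Hp xs s erefl; rewrite /R /F EK EQ ED addKn; exact.
Qed.

(* Program z' ++ i ++ alpha ++ n ++ 1 0^L: wait until more than i prefixes are heavy. *)
Lemma rank_prf e c : exists p, forall L n al i d w s,
  let r := n - (al + 6 * L) in
  let T := r + L + 2 + c + al in
  let l := al + L + 3 + c in
  n < 2 ^ L.+1 -> al < 2 ^ L.+1 -> i < 2 ^ l -> w < 2 ^ d ->
  i < heavies e T r (al + 6 * L) s.+1 ->
  (forall s', s' < s -> heavies e T r (al + 6 * L) s'.+1 <= i) ->
  conv p [:: (((((2 ^ d + w) * 2 ^ l + i) * 2 ^ L.+1 + al) * 2 ^ L.+1 + n) * 2 ^ L.+1
              + 2 ^ L).-1]
    (out e T s %/ 2 ^ r * 2 ^ d + w).-1.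
Proof.
(* L is read first, then n and alpha of width L + 1, then i, whose width depends on alpha and L; the
   rest is 1z', where z' has length [d]. *)
pose pL xs := logn 2 (nth 0 xs 0).+1.
pose Q1 xs := (nth 0 xs 0).+1 %/ 2 ^ (pL xs).+1.
pose pn xs := Q1 xs %% 2 ^ (pL xs).+1.
pose Q2 xs := Q1 xs %/ 2 ^ (pL xs).+1.
pose pal xs := Q2 xs %% 2 ^ (pL xs).+1.
pose Q3 xs := Q2 xs %/ 2 ^ (pL xs).+1.
pose pl xs := pal xs + pL xs + 3 + c.
pose pi xs := Q3 xs %% 2 ^ pl xs.
pose Q4 xs := Q3 xs %/ 2 ^ pl xs.
pose pd xs := trunc_log 2 (Q4 xs).
pose pm xs := pal xs + 6 * pL xs.
pose pr xs := pn xs - pm xs.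
pose pT xs := pr xs + pL xs + 2 + c + pal xs.
have tL : tcomp 1 pL by rewrite /pL; tc.
have tQ1 : tcomp 1 Q1 by rewrite /Q1; tc.
have tn : tcomp 1 pn by rewrite /pn; tc.
have tQ2 : tcomp 1 Q2 by rewrite /Q2; tc.
have tal : tcomp 1 pal by rewrite /pal; tc.
have tQ3 : tcomp 1 Q3 by rewrite /Q3; tc.
have tl : tcomp 1 pl by rewrite /pl; tc.
have ti : tcomp 1 pi by rewrite /pi; tc.
have tQ4 : tcomp 1 Q4 by rewrite /Q4; tc.
have td : tcomp 1 pd by rewrite /pd; tc.
have tm : tcomp 1 pm by rewrite /pm; tc.
have tr : tcomp 1 pr by rewrite /pr; tc.
have tT : tcomp 1 pT by rewrite /pT; tc.
pose R s xs := pi xs < heavies e (pT xs) (pr xs) (pm xs) s.+1.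
pose F s xs := (out e (pT xs) s %/ 2 ^ pr xs * 2 ^ pd xs + (Q4 xs - 2 ^ pd xs)).-1.
have [||p Hp] := @conv_search 1 R F.
- by apply: tcomp_leq; first tc; apply: tcomp_heavies; tc.
- rewrite /F; apply: tcomp_pred; apply: tcomp_add; last by tc.
  by apply: tcomp_mul; last tc; apply: tcomp_div2; last tc; apply: tcomp_out; tc.
exists p => L n al i d w s r T l ltn lta lti ltw His Hmin.
set xs := [:: _].
have E0 : (nth 0 xs 0).+1 =
    ((((2 ^ d + w) * 2 ^ l + i) * 2 ^ L.+1 + al) * 2 ^ L.+1 + n) * 2 ^ L.+1 + 2 ^ L.
  by rewrite /= prednK // addn_gt0 !expn_gt0 orbT.
have EL : pL xs = L by rewrite /pL E0 logn_field.
have ltL : 2 ^ L < 2 ^ L.+1 by rewrite ltn_exp2l.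
have E1 : Q1 xs = (((2 ^ d + w) * 2 ^ l + i) * 2 ^ L.+1 + al) * 2 ^ L.+1 + n.
  by rewrite /Q1 E0 EL divn_field.
have En : pn xs = n by rewrite /pn E1 EL modn_field.
have E2 : Q2 xs = ((2 ^ d + w) * 2 ^ l + i) * 2 ^ L.+1 + al.
  by rewrite /Q2 E1 EL divn_field.
have Ea : pal xs = al by rewrite /pal E2 EL modn_field.
have E3 : Q3 xs = (2 ^ d + w) * 2 ^ l + i by rewrite /Q3 E2 EL divn_field.
have El : pl xs = l by rewrite /pl Ea EL.
have Ei : pi xs = i by rewrite /pi E3 El modn_field.
have E4 : Q4 xs = 2 ^ d + w by rewrite /Q4 E3 El divn_field.
have Ed : pd xs = d by rewrite /pd E4 trunc_log_field.
have Em : pm xs = al + 6 * L by rewrite /pm Ea EL.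
have Er : pr xs = r by rewrite /pr Em En.
have ET : pT xs = T by rewrite /pT Er Ea EL.
have := Hp xs s erefl; rewrite /R /F Ei ET Er Em Ed E4 addKn; apply=> // j ltj.
by rewrite -leqNgt; exact: Hmin.
Qed.

(** * Light prefixes and the count of their complex extensions *)

Lemma field_lt K a j b : a < 2 ^ K.+1 -> b < 2 ^ j -> a * 2 ^ j + b < 2 ^ (K + j).+1.
Proof.
move=> Ha Hb; rewrite -(addSn K) expnD.
apply: (@leq_trans (a.+1 * 2 ^ j)); first by rewrite mulSn; lia.
by rewrite leq_mul2r Ha orbT.
Qed.

Lemma code_ex K v : 0 < v -> v < 2 ^ K.+1 -> exists2 s, (code s).+1 = v & size s <= K.
Proof.
case: v => // v _ ltv; have [s [Hs Ss]] := bits_code v; exists s => //.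
rewrite Ss -ltnS -(@ltn_exp2l 2) //.
by apply: leq_ltn_trans ltv; exact: trunc_logP.
Qed.

Definition btuple (n v : nat) : n.-tuple bool := Tuple (introT eqP (size_bits n v)).

(** A program shorter than [T] has code below [2 ^ T], so the enumeration runs it for every number
    of steps. *)
Lemma KC_lt_hit U e T y :
  universal U -> (forall p y, U p = Some y <-> conv e [:: code p] (code y)) ->
  KC U y < T -> exists s, hit e T s (code y).+1.
Proof.
move=> HU He; have [q /He/conv_stepf[t Ht] <-] := KC_ex y HU => ltq.
have ltc : code q < 2 ^ T.
  have /andP[_ H] := code_bounds q.
  by apply: leq_trans (ltnW H) _; rewrite leq_exp2l.
exists (t * 2 ^ T + code q).+1; apply/hitP; exists (t * 2 ^ T + code q) => //.
by rewrite /out divn_field ?modn_field.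
Qed.

(** If the prefix were heavy, its rank and the remaining [k - m] bits of [p0] would give a
    description of x shorter than [KC U x]. *)
Lemma prefix_not_heavy U e c : universal U ->
  (forall p y, U p = Some y <-> conv e [:: code p] (code y)) ->
  exists c', forall L n al x p0 s,
    let k := size p0 in
    let m := al + 6 * L in
    let r := n - m in
    U p0 = Some x -> KC U x = k -> m <= k -> n < 2 ^ L.+1 -> al < 2 ^ L.+1 ->
    c' <= L ->
    ~~ heavy e (r + L + 2 + c + al) r s ((code p0).+1 %/ 2 ^ (k - m)).
Proof.
move=> HU He; have [p1 Hp1] := rank_prf e c.
(* [p1] rebuilds [p0], and [e] then runs it to obtain x. *)
have [c2 Hc2] := KC_prf (PComp e [:: p1]) HU.
(* The description has at most [(k - m) + l + 3 * L.+1] bits, which is k - 2 L + c + 6; with the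
   decoding cost [c2] this is below [k] for such L. *)
exists (c + c2 + 7) => L n al x p0 s0 k m r Up Kx lemk ltn lta ltc.
set P := (code p0).+1; set d := k - m; set u := P %/ 2 ^ d.
set T := r + L + 2 + c + al; set l := al + L + 3 + c.
have ltPu : P %% 2 ^ d < 2 ^ d by rewrite ltn_mod expn_gt0.
have /andP[leP ltP] := code_bounds p0.
have Ek : 2 ^ k = 2 ^ m * 2 ^ d by rewrite -expnD subnKC.
have leu : 2 ^ m <= u by rewrite leq_divRL ?expn_gt0 // -Ek.
have ltu : u < 2 ^ m.+1.
  by rewrite ltn_divLR ?expn_gt0 // expnS -mulnA -Ek -expnS.
apply/negP => hv.
have ltz : u - 2 ^ m < 2 ^ m by rewrite expnS in ltu; lia.
have Eu : 2 ^ m + (u - 2 ^ m) = u by rewrite subnKC.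
have [|s [i [His Hmin Hout]]] := @heavy_rank e T r m s0 _ ltz; first by rewrite Eu.
(* The number of heavy prefixes is at most [2 ^ (T + 1 - r)], and [l] is this exponent. *)
have lti : i < 2 ^ l.
  apply: leq_trans His _.
  rewrite -(@leq_pmul2r (2 ^ r)) ?expn_gt0 //.
  apply: leq_trans (heavies_bound _ _ _ _ _) _.
  by rewrite -expnS -expnD leq_exp2l // /T /l; lia.
have := Hp1 L n al i d (P %% 2 ^ d) s ltn lta lti ltPu His Hmin.
rewrite Hout Eu -divn_eq /=.
have ltL : 2 ^ L < 2 ^ L.+1 by rewrite ltn_exp2l.
have ltd : 2 ^ d + P %% 2 ^ d < 2 ^ d.+1 by rewrite [2 ^ d.+1]expnS; lia.
have lt := field_lt (field_lt (field_lt (field_lt ltd lti) lta) ltn) ltL.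
have [|q Eq Sq] := code_ex _ lt; first by rewrite addn_gt0 !expn_gt0 orbT.
rewrite -Eq /= => Hq.
have /Hc2 : conv (PComp e [:: p1]) [:: code q] (code x).
  apply: (conv_comp (p := fun _ : unit => p1) (a := fun=> code p0) (js := [:: tt])).
    by move=> _.
  exact/He.
by rewrite Kx /l -/k in Sq *; lia.
Qed.

(** The theorem in integer form, with the rounded-down logarithm [L] and bound
    [2 ^ (n - al - 6 * L)]. *)
Lemma A_set_card U V : universal U -> cond_universal V ->
  exists N, forall n al (x : n.-tuple bool), let L := trunc_log 2 n in
    N <= n -> al + 7 * L <= KC U x ->
    al + 6 * L <= n /\ 2 ^ (n - (al + 6 * L)) <= 2 * #|A_set U V al x|.
Proof.
move=> HU HV; have [e He] := HU.1.
have [c0 Hc0] := KC_size HU.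
have [p2 Hp2] := splice_prf e.
have [c1 Hc1] := KCc_prf p2 HV.
have [c2 Hc2] := prefix_not_heavy c1 HU He.
(* This forces [c0 + c2 < L]: then [k <= n + c0] yields [m <= n] and [k < 2 ^ (L + 2)], and
   [c2 <= L] makes the prefix light. *)
exists (2 ^ (c0 + c2 + 1)) => n al x L leN Hk.
have n0 : 0 < n by apply: leq_trans leN; rewrite expn_gt0.
have leL : c0 + c2 + 1 <= L by apply: trunc_log_max.
have ltn : n < 2 ^ L.+1 by apply: trunc_log_ltn.
have := Hc0 x; rewrite size_tuple; set k := KC U x in Hk * => lek.
set m := al + 6 * L; set r := n - m.
have lemk : m <= k by rewrite /m; lia.
have lemn : m <= n by rewrite /m; lia.
split=> //.
have ltL : L < 2 ^ L by exact: ltn_expl.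
have ltk : k < 2 ^ (L + 2).
  by rewrite addnC !expnS in ltn *; lia.
have [p Up Sp] := KC_ex x HU.
have En : trunc_log 2 (code x).+1 = n by rewrite trunc_log_code size_tuple.
pose R s := stepf e [:: s %/ 2 ^ k; (2 ^ k + s %% 2 ^ k).-1] == (code x).+1.
have exR : exists s, R s.
  have /conv_stepf[t Ht] := (He p x).1 Up.
  have /andP[] := code_bounds p; rewrite Sp -/k expnS => b1 b2.
  have ltq : (code p).+1 - 2 ^ k < 2 ^ k by lia.
  exists (t * 2 ^ k + ((code p).+1 - 2 ^ k)).
  by rewrite /R divn_field // modn_field // subnKC //= Ht.
(* The least [s] singles out a program of x of length [k], recoverable from x and [k]; this [p0]
   takes the role of x*, while [p] only shows that the search succeeds. *)
have [s Rs mins] := ex_minnP exR.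
have Rmin i : i < s -> ~~ R i.
  by move=> lti; apply/negP => /mins; rewrite leqNgt lti.
set q := s %% 2 ^ k; have ltq : q < 2 ^ k by rewrite ltn_mod expn_gt0.
pose p0 := bits k q.
have E0 : (code p0).+1 = 2 ^ k + q by apply: code_bits.
have S0 : size p0 = k by apply: size_bits.
have Up0 : U p0 = Some (tval x).
  apply/He/conv_stepf; exists (s %/ 2 ^ k).
  by rewrite -[code p0]/(code p0).+1.-1 E0; apply/eqP.
set u := (2 ^ k + q) %/ 2 ^ (k - m).
(* [r + L + 2 + c1] bounds the conditional complexity of y given x, so complexity at least [T] puts
   y into the set. *)
set T := r + L + 2 + c1 + al.
have light s' : ~~ heavy e T r s' u.
  have := Hc2 L n al x p0 s' Up0; rewrite S0 E0; apply=> //.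
  - by rewrite /m in lemn; lia.
  - by lia.
have Ek : 2 ^ k = 2 ^ m * 2 ^ (k - m) by rewrite -expnD subnKC.
have leu : 2 ^ m <= u by rewrite leq_divRL ?expn_gt0 // -Ek leq_addr.
have ltu : u < 2 ^ m.+1.
  rewrite ltn_divLR ?expn_gt0 // expnS -mulnA -Ek; lia.
have Enm : 2 ^ n = 2 ^ m * 2 ^ r by rewrite -expnD subnKC.
pose y w := btuple n ((u - 2 ^ m) * 2 ^ r + w).
have code_y w : w < 2 ^ r -> (code (y w)).+1 = u * 2 ^ r + w.
  move=> ltw; rewrite code_bits ?Enm.
    by rewrite mulnBl addnA subnKC // leq_mul2r leu orbT.
  rewrite expnS in ltu.
  apply: (@leq_trans ((u - 2 ^ m).+1 * 2 ^ r)); first by rewrite mulSn; lia.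
  by rewrite leq_mul2r; apply/orP; right; lia.
have Cy w : w < 2 ^ r -> KCc V (y w) x <= r + (L + 2) + c1.
  move=> ltw.
  have ltd : 2 ^ r + w < 2 ^ r.+1 by rewrite [2 ^ r.+1]expnS; lia.
  have [|pw Epw Spw] := code_ex _ (field_lt ltd ltk).
    by rewrite addn_gt0 muln_gt0 addn_gt0 !expn_gt0.
  apply: leq_trans (Hc1 pw x _ _) _; last by rewrite leq_add2r.
  have := Hp2 k w r (code x) s; rewrite En -/L => /(_ ltk ltw Rs Rmin).
  by rewrite subKn // -/q -/u -Epw -code_y.
pose B w := KC U (y w) < T.
(* Even once every [w] with [B w] has been hit, the prefix is not heavy. *)
have few : 2 * \sum_(w < 2 ^ r) B w < 2 ^ r.
  have [|s' Hs'] := @hits_exhaust e T r u B.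
    by move=> w ltw /(KC_lt_hit HU He); rewrite code_y.
  rewrite ltnNge; apply/negP => H; have /negP[] := light s'.
  by rewrite /heavy (leq_trans H) // leq_mul2l.
pose G := [set w : 'I_(2 ^ r) | ~~ B w].
have cG : \sum_(w < 2 ^ r) B w + #|G| = 2 ^ r.
  rewrite -sum1_card [X in _ + X]big_mkcond -big_split /=.
  rewrite (eq_bigr (fun=> 1)) ?sum1_card ?card_ord // => w _.
  by rewrite inE; case: (B w).
(* By [few] and [cG], more than half of all [w] lie in [G]. *)
suff : #|G| <= #|A_set U V al x| by lia.
have yinj : {in G &, injective (fun w : 'I_(2 ^ r) => y w)}.
  move=> w w' _ _ H; apply/ord_inj/(@addnI (u * 2 ^ r)).
  by rewrite -!code_y ?ltn_ord // H.
rewrite -(card_in_imset yinj); apply/subset_leq_card/subsetP => _ /imsetP[w Gw ->].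
move: Gw; rewrite !inE /B -leqNgt /T => Gw.
have := Cy w (ltn_ord w) => Cw.
apply/Z.geb_le; lia.
Qed.

(** * Passage to real numbers *)

Lemma INR_expn a k : INR (a ^ k) = (INR a ^ k)%R.
Proof. by elim: k => //= k IH; rewrite expnS mult_INR IH. Qed.

Theorem theorem1 (U : seq bool -> option (seq bool))
    (V : seq bool -> seq bool -> option (seq bool))
    (HU : universal U) (HV : cond_universal V) :
  exists N : nat, forall n : nat, (N <= n)%nat ->
    forall (alpha : nat) (x : n.-tuple bool),
      (INR (KC U x) >= INR alpha + 7 * (ln (INR n) / ln 2))%R ->
      (INR #|A_set U V alpha x| >=
         / (2 * INR n ^ 7) * powerRZ 2 (Z.of_nat n - Z.of_nat alpha))%R.
Proof.
have [N HN] := A_set_card HU HV.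
(* The successor guarantees [n > 0], so that the logarithm is meaningful. *)
exists N.+1 => n ltN al x HK.
set L := trunc_log 2 n.
have n0 : 0 < n by exact: leq_trans ltN.
have n0R : (0 < INR n)%R by apply/lt_0_INR/ltP.
have le2L : 2 ^ L <= n by exact: trunc_logP.
have ln2 : (0 < ln 2)%R by rewrite -ln_1; apply: ln_increasing; lra.
have leLR : (INR L <= ln (INR n) / ln 2)%R.
  apply: (Rmult_le_reg_r (ln 2)) => //.
  rewrite /Rdiv Rmult_assoc Rinv_l ?Rmult_1_r; last lra.
  rewrite -ln_pow; last lra.
  have -> : 2%R = INR 2 by [].
  have p0 : (0 < INR (2 ^ L))%R by apply/lt_0_INR/ltP; rewrite expn_gt0.
  rewrite -INR_expn; case: (le_INR _ _ (elimT leP le2L)) => [lt|->].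
    exact/Rlt_le/ln_increasing.
  exact: Rle_refl.
have [||leal leA] := HN n al x; first exact: ltnW.
  apply/leP/INR_le; rewrite plus_INR mult_INR; move: HK leLR.
  by rewrite -/L /=; lra.
set a := #|_| in leA *.
(* As [2 ^ L <= n], the factor [2 ^ (6 * L)] is at most [n ^ 6], hence at most [n ^ 7]. *)
have lea : 2 ^ (n - al) <= 2 * a * n ^ 7.
  have -> : n - al = (n - (al + 6 * L)) + L * 6 by lia.
  rewrite expnD expnM; apply: leq_mul => //.
  apply: (@leq_trans (n ^ 6)); first by rewrite leq_exp2r.
  by rewrite leq_pexp2l.
(* [leal] gives [al <= n], so truncated and integer subtraction agree. *)
have -> : (Z.of_nat n - Z.of_nat al)%Z = Z.of_nat (n - al) by lia.
rewrite -pow_powerRZ; apply: Rle_ge.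
have p7 : (0 < INR n ^ 7)%R by apply: pow_lt.
apply: (Rmult_le_reg_l (2 * INR n ^ 7)); first lra.
rewrite -Rmult_assoc Rinv_r ?Rmult_1_l; last lra.
have := le_INR _ _ (elimT leP lea); rewrite !mult_INR !INR_expn.
by rewrite (_ : INR 2 = 2%R) //; lra.
Qed.
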